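(* Let $X$ be a homogeneous space with respect to a reductive Lie group $G$, and let $\mathscr{H}(X)$ be a Hilbert space of complex-valued functions on $X$ admitting a positive definite reproducing kernel $K : X \times X \to \mathbb{C}$. For $z \in X$ let $e_z := K(\cdot, z) \in \mathscr{H}(X)$ be the coherent state at $z$. Let $\Gamma$ be a discrete topological subspace of $X$, fix an enumeration $\gamma_1, \gamma_2, \ldots$ of $\Gamma$, and define $\Gamma_n = \{\gamma_k \in \Gamma : 1 \leq k \leq n\}$ for $n \geq 1$. Suppose that the linear span of the coherent states $(e_\gamma)_{\gamma \in \Gamma}$ is dense in $\mathscr{H}(X)$. For $f \in \mathscr{H}(X)$ let $W(f|_{\Gamma_n})$ denote the Whitney function for $f|_{\Gamma_n}$ in the span of the coherent states of $\Gamma_n$, i.e. the element of $\operatorname{span}_{\mathbb{C}}\{e_\gamma : \gamma \in \Gamma_n\}$ satisfying $W(f|_{\Gamma_n})(\gamma) = f(\gamma)$ for all $\gamma \in \Gamma_n$. Then for every smooth $f \in \mathscr{H}(X)$, $$W(f|_{\Gamma_n}) \longrightarrow f \quad \text{as } n \to \infty$$ in the norm topology of $\mathscr{H}(X)$, and $W(f|_{\Gamma_n})(z) \to f(z)$ as $n \to \infty$ for every $z \in X$.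
   Context: The reproducing property of $K$ means that for every $z \in X$ the function $e_z = K(\cdot, z)$ belongs to $\mathscr{H}(X)$ and $f(z) = \langle f, e_z \rangle$ for all $f \in \mathscr{H}(X)$, the inner product being linear in the first argument. Positive definiteness of $K$ is meant in the strict sense: for any finite set of distinct points $z_1, \dots, z_m \in X$ the matrix $(K(z_j, z_k))_{j,k}$ is positive definite, in particular invertible; equivalently, the functions $e_{z_1}, \dots, e_{z_m}$ are linearly independent. Consequently the interpolating element $W(f|_{\Gamma_n})$ of $\operatorname{span}_{\mathbb{C}}\{e_\gamma : \gamma \in \Gamma_n\}$ exists and is unique. The homogeneous space $X = G/H$ is second countable, so every discrete subspace $\Gamma$ of $X$ is countable. *)

(* Defs.v *)
From HB Require Import structures.
From mathcomp Require Import all_boot all_order all_algebra.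
From mathcomp Require Import complex.
From mathcomp Require Import all_classical all_reals all_analysis.

Set Implicit Arguments.
Unset Strict Implicit.
Unset Printing Implicit Defensive.

Import Order.TTheory GRing.Theory Num.Theory.
Import numFieldNormedType.Exports.

Local Open Scope classical_set_scope.
Local Open Scope ring_scope.

(* For U open and V finite-dimensional (the only use below), this is the usual
   notion: all iterated directional derivatives up to order k exist and are
   continuous on U. *)
Fixpoint Ck_on (R : realType) (V W : normedModType R) (k : nat)
    (U : set V) (f : V -> W) : Prop :=
  match k with
  | 0 => forall x, U x -> {for x, continuous f}
  | k'.+1 => (forall x v, U x -> derivable f x v) /\
             (forall v, Ck_on k' U (fun x => derive f x v))
  end.

Definition smooth_on (R : realType) (V W : normedModType R)
    (U : set V) (f : V -> W) : Prop :=
  forall k, Ck_on k U f.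

(* [chart_map] and [chart_inv] are total functions, meaningful only on
   [chart_dom] and on its image respectively. *)
Record chart (R : realType) (T : topologicalType) (n : nat) := Chart {
  chart_dom : set T ;
  chart_map : T -> 'rV[R]_n ;
  chart_inv : 'rV[R]_n -> T ;
  chart_dom_open : open chart_dom ;
  chart_img_open : open (chart_map @` chart_dom) ;
  chart_mapK : forall x, chart_dom x -> chart_inv (chart_map x) = x ;
  chart_map_continuous :
    forall x, chart_dom x -> {for x, continuous chart_map} ;
  chart_inv_continuous :
    forall y, (chart_map @` chart_dom) y -> {for y, continuous chart_inv}
}.

Record manifold (R : realType) (T : topologicalType) := Manifold {
  mfd_dim : nat ;
  mfd_atlas : set (chart R T mfd_dim) ;
  mfd_hausdorff : hausdorff_space T ;
  mfd_second_countable : @second_countable T ;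
  mfd_cover : forall x, exists2 c, mfd_atlas c & chart_dom c x ;
  mfd_compatible : forall c d, mfd_atlas c -> mfd_atlas d ->
    smooth_on (chart_map c @` (chart_dom c `&` chart_dom d))
              (chart_map d \o chart_inv c)
}.
Arguments mfd_atlas {R T} m _.

Definition smooth_fun (R : realType) (T : topologicalType) (M : manifold R T)
    (f : T -> R) : Prop :=
  forall c, mfd_atlas M c ->
    smooth_on (chart_map c @` chart_dom c) (f \o chart_inv c).

Definition smooth_cfun (R : realType) (T : topologicalType) (M : manifold R T)
    (f : T -> R[i]) : Prop :=
  smooth_fun M (fun x => complex.Re (f x)) /\
  smooth_fun M (fun x => complex.Im (f x)).

Definition smooth_map (R : realType) (S T : topologicalType)
    (M : manifold R S) (N : manifold R T) (f : S -> T) : Prop :=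
  continuous f /\
  forall c d, mfd_atlas M c -> mfd_atlas N d ->
    smooth_on (chart_map c @` (chart_dom c `&` f @^-1` chart_dom d))
              (chart_map d \o f \o chart_inv c).

(* Smoothness on the product manifold, in the product charts
   (x, y) |-> (c x, c' y). *)
Definition smooth_map2 (R : realType) (S S' T : topologicalType)
    (M : manifold R S) (M' : manifold R S') (N : manifold R T)
    (f : S -> S' -> T) : Prop :=
  continuous (fun p : S * S' => f p.1 p.2) /\
  forall c c' d, mfd_atlas M c -> mfd_atlas M' c' -> mfd_atlas N d ->
    smooth_on
      ((fun p : S * S' => (chart_map c p.1, chart_map c' p.2)) @`
         [set p | [/\ chart_dom c p.1, chart_dom c' p.2
                    & chart_dom d (f p.1 p.2)]])
      (fun u => chart_map d (f (chart_inv c u.1) (chart_inv c' u.2))).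

#[short(type="groupTopologicalType")]
HB.structure Definition GroupTopological := {G of Group G & Topological G}.

Record lie_group (R : realType) := LieGroup {
  lg_sort :> groupTopologicalType ;
  lg_manifold : manifold R lg_sort ;
  lg_mul_smooth : smooth_map2 lg_manifold lg_manifold lg_manifold
    (fun x y : lg_sort => (x * y)%g) ;
  lg_inv_smooth : smooth_map lg_manifold lg_manifold
    (fun x : lg_sort => (x^-1)%g)
}.

(* The Lie algebra of G: left-invariant derivations of the algebra of smooth
   real functions on G. An operator on all functions is normalised to vanish on
   non-smooth ones, so that equality of operators is equality on smooth
   functions. *)
Definition lie_algebra (R : realType) (G : lie_group R) :
    set ((G -> R) -> (G -> R)) :=
  let smooth := smooth_fun (lg_manifold G) in
  [set D | [/\ forall f, ~ smooth f -> D f = 0,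
               forall f, smooth f -> smooth (D f),
               forall (a : R) f g, smooth f -> smooth g ->
                 D (a *: f + g) = a *: D f + D g,
               forall f g, smooth f -> smooth g ->
                 D (f \* g) = (f \* D g) + (g \* D f)
             & forall (x : G) f, smooth f ->
                 D (fun y => f (x * y)%g) = (fun y => D f (x * y)%g)]].
Arguments lie_algebra {R} G _.

Definition lie_bracket (R : realType) (G : lie_group R)
    (D E : (G -> R) -> (G -> R)) : (G -> R) -> (G -> R) :=
  fun f => D (E f) - E (D f).

Definition lie_ideal (R : realType) (G : lie_group R)
    (A : set ((G -> R) -> (G -> R))) : Prop :=
  [/\ A `<=` lie_algebra G,
      A 0,
      forall (a : R) D E, A D -> A E -> A (a *: D + E)
    & forall D E, lie_algebra G D -> A E -> A (lie_bracket D E)].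
Arguments lie_ideal {R} G A.

(* Reductivity of a Lie group is taken as reductivity of its Lie algebra, i.e.
   every ideal has a complementary ideal; the narrower conventions (linear,
   Harish-Chandra class) all imply it. *)
Definition reductive (R : realType) (G : lie_group R) : Prop :=
  forall A, lie_ideal G A ->
    exists B, [/\ lie_ideal G B,
                  A `&` B = [set 0]
                & forall D, lie_algebra G D ->
                    exists D1 D2, [/\ A D1, B D2 & D = D1 + D2]].

Record homogeneous_space (R : realType) (G : lie_group R) := HomogeneousSpace {
  hs_sort :> topologicalType ;
  hs_manifold : manifold R hs_sort ;
  hs_act : G -> hs_sort -> hs_sort ;
  hs_act1 : forall x, hs_act 1%g x = x ;
  hs_actM : forall g h x, hs_act (g * h)%g x = hs_act g (hs_act h x) ;
  hs_act_smooth : smooth_map2 (lg_manifold G) hs_manifold hs_manifold hs_act ;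
  hs_nonempty : [set: hs_sort] !=set0 ;
  hs_transitive : forall x y, exists g, hs_act g x = y
}.

(* A Hilbert space of C-valued functions on X, used with C := R[i]. [fhs_eval]
   identifies its elements with functions, and the inner product is linear in
   its first argument. *)
Record function_hilbert_space (C : numClosedFieldType) (X : Type) :=
  FunctionHilbertSpace {
  fhs_sort :> completeNormedModType C ;
  fhs_dot : {dot fhs_sort for Num.conj} ;
  fhs_norm : forall f : fhs_sort, `|f| ^+ 2 = fhs_dot f f ;
  fhs_eval : {linear fhs_sort -> (X -> C)} ;
  fhs_eval_inj : injective fhs_eval
}.
Arguments fhs_dot {C X H} : rename.
Arguments fhs_eval {C X H} : rename.

Definition positive_definite (C : numClosedFieldType) (X : Type)
    (K : X -> X -> C) : Prop :=
  forall (m : nat) (z : 'I_m -> X), injective z ->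
  forall c : 'I_m -> C, (exists j, c j != 0) ->
    0 < \sum_(j < m) \sum_(k < m) (c j)^* * K (z j) (z k) * c k.

Definition reproducing_kernel (C : numClosedFieldType) (X : Type)
    (H : function_hilbert_space C X) (K : X -> X -> C) (e : X -> H) : Prop :=
  (forall z, fhs_eval (e z) = K ^~ z) /\
  (forall z (f : H), fhs_eval f z = fhs_dot f (e z)).

Definition lin_span (C : pzRingType) (V : lmodType C) (A : set V) : set V :=
  [set v | exists (m : nat) (a : 'I_m -> C) (u : 'I_m -> V),
             (forall i, A (u i)) /\ v = \sum_(i < m) a i *: u i].

Definition discrete_subspace (T : topologicalType) (A : set T) : Prop :=
  A `<=` isolated A.

(* The index set I is an initial segment of nat, so that both finite and
   infinite sets are covered; indices start at 0. *)
Definition enumeration (T : Type) (A : set T) (I : set nat) (s : nat -> T) :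
    Prop :=
  (forall j k, (j <= k)%N -> I k -> I j) /\ set_bij I A s.

Definition first_terms (T : Type) (I : set nat) (s : nat -> T) (n : nat) :
    set T :=
  s @` [set k | I k /\ (k < n)%N].

(* The element of span {e x | x in A} that agrees with f on A; it exists and is
   unique for A finite when the kernel is positive definite. *)
Definition whitney (C : numClosedFieldType) (X : Type)
    (H : function_hilbert_space C X) (e : X -> H) (A : set X) (f : H) : H :=
  xget 0 [set g | lin_span (e @` A) g /\
                  forall x, A x -> fhs_eval g x = fhs_eval f x].

(* Main.v *)
Require Import Defs.
From mathcomp Require Import all_boot all_order all_algebra.
From mathcomp Require Import complex.
From mathcomp Require Import all_classical all_reals all_analysis.
Import Order.TTheory GRing.Theory Num.Theory.
Import numFieldNormedType.Exports.
Local Open Scope classical_set_scope.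
Local Open Scope ring_scope.

(** By the reproducing property, interpolation of [f] on a set [A] says exactly
    that [f - g] is orthogonal to the coherent states of [A]. Hence the Whitney
    function, which exists because the Gram matrix of distinct coherent states
    is invertible, is the best approximation of [f] in their span. These spans
    increase with [n] and their union is dense, which gives convergence in norm;
    pointwise convergence follows by Cauchy-Schwarz against [e z]. *)

(** Pythagoras: [a *: v] is the orthogonal projection of [u] onto the line of [v], so [form u u] is
    at least the squared length of this projection. *)
Lemma dot_CauchySchwarz {C : numClosedFieldType} {U : lmodType C}
    (form : {dot U for Num.conj}) (u v : U) :
  `|form u v| ^+ 2 <= form u u * form v v.
Proof.
have [->|v0] := eqVneq v 0.
  by rewrite linear0r normr0 expr0n linear0r mulr0.
have vv_gt0 : 0 < form v v by rewrite dnorm_gt0.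
pose a := form u v / form v v.
have wv : form (u - a *: v) (a *: v) = 0.
  by rewrite linearZr_LR linearBl linearZl_LR /= divfK ?gt_eqF// subrr mulr0.
have -> : form u u = form (u - a *: v) (u - a *: v) + `|a| ^+ 2 * form v v.
  by rewrite -dnormZ -(hnormDd wv) subrK.
rewrite mulrDl -[leLHS]add0r lerD//.
  by rewrite mulr_ge0// ?dnorm_ge0.
by rewrite -mulrA -expr2 -(gtr0_norm vv_gt0) -exprMn -normrM divfK ?gt_eqF.
Qed.

(** A nonzero row vector in the left kernel of the Gram matrix would be a nonzero isotropic vector
    of the form, so the kernel is trivial and the matrix is invertible. *)
Lemma positive_definite_solvable {C : numClosedFieldType} {X : Type}
    (K : X -> X -> C) (HK : positive_definite K) (m : nat) (z : 'I_m -> X)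
    (y : 'I_m -> C) : injective z ->
  exists c : 'I_m -> C, forall j, \sum_(k < m) c k * K (z j) (z k) = y j.
Proof.
move=> z_inj; pose A := \matrix_(j < m, k < m) K (z j) (z k).
have Au : A \in unitmx.
  rewrite -row_free_unit -kermx_eq0; apply/eqP/row_matrixP => i; rewrite row0.
  apply/eqP; apply/negP => /negP/rV0Pn[j vj0].
  have /matrixP vA0 : row i (kermx A) *m A = 0.
    by rewrite -row_mul mulmx_ker row0.
  set v := row i (kermx A) in vj0 vA0.
  (* The form conjugates its left coefficients, so it is tested on the conjugate of [v]; summing
     over [j] first then yields the entries of [v *m A], all zero. *)
  have := HK m z z_inj (fun j => (v 0 j)^*).
  suff -> : \sum_j \sum_k ((v 0 j)^*)^* * K (z j) (z k) * (v 0 k)^* = 0.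
    rewrite ltxx => v0; suff : false by [].
    by apply: v0; exists j; rewrite conjC_eq0.
  rewrite exchange_big big1// => k _; rewrite -mulr_suml.
  have := vA0 0 k; rewrite mxE [RHS]mxE => vAk.
  suff -> : \sum_i0 ((v 0 i0)^*)^* * K (z i0) (z k) = 0 by rewrite mul0r.
  by apply: etrans vAk; apply: eq_bigr => l _; rewrite conjCK [A l k]mxE.
exists (fun k => (invmx A *m (\col_j y j)) k 0) => j.
have /matrixP/(_ j 0) : A *m (invmx A *m (\col_j y j)) = \col_j y j.
  by rewrite mulKVmx.
rewrite !mxE => <-; apply: eq_bigr => k _.
by rewrite [A j k]mxE mulrC.
Qed.

Lemma lin_spanS {C : pzRingType} {V : lmodType C} (A B : set V) :
  A `<=` B -> lin_span A `<=` lin_span B.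
Proof.
move=> AB v [m [a [u [Au ->]]]]; exists m, a, u; split=> // i.
exact/AB/Au.
Qed.

Lemma lin_span_sub {C : pzRingType} {V : lmodType C} (A : set V) (v w : V) :
  lin_span A v -> lin_span A w -> lin_span A (v - w).
Proof.
move=> [m [a [u [Au ->]]]] [p [b [t [At ->]]]].
exists (m + p)%N,
  (fun i => match fintype.split i with inl j => a j | inr j => - b j end),
  (fun i => match fintype.split i with inl j => u j | inr j => t j end).
split=> [i|]; first by case: fintype.split.
rewrite big_split_ord /= -sumrN; congr (_ + _); apply: eq_bigr => i _.
  by rewrite (unsplitK (inl i)).
by rewrite (unsplitK (inr i)) scaleNr.
Qed.

Lemma lin_span_orthogonal {C : numClosedFieldType} {V : lmodType C}
    (form : {dot V for Num.conj}) (A : set V) (u v : V) :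
  (forall x, A x -> form u x = 0) -> lin_span A v -> form u v = 0.
Proof.
move=> uA [m [a [t [At ->]]]]; rewrite linear_sumr big1// => i _.
by rewrite linearZr_LR /= uA// mulr0.
Qed.

(** Solving the Gram system with right-hand side [f (z j)] gives an interpolant, so the default
    value 0 of [xget] in [whitney] is never a fallback here. *)
Lemma whitney_exists {C : numClosedFieldType} {X : Type}
    (H : function_hilbert_space C X) (K : X -> X -> C)
    (HK : positive_definite K) (e : X -> H) (He : reproducing_kernel K e)
    (m : nat) (z : 'I_m -> X) (f : H) : injective z ->
  lin_span (e @` range z) (whitney e (range z) f) /\
  forall x, range z x -> fhs_eval (whitney e (range z) f) x = fhs_eval f x.
Proof.
move=> z_inj.
have [c cf] :=
  positive_definite_solvable K HK m z (fun j => fhs_eval f (z j)) z_inj.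
rewrite /whitney; case: xgetP => [g _ []//|].
move=> /(_ (\sum_(k < m) c k *: e (z k))) []; split.
  by exists m, c, (e \o z); split => // i; exists (z i) => //; exists i.
move=> _ [j _ <-]; rewrite -cf linear_sum /= fct_sumE; apply: eq_bigr => k _.
by rewrite linearZ /= He.1.
Qed.

Lemma fhs_evalB {C : numClosedFieldType} {X : Type}
    (H : function_hilbert_space C X) (f g : H) (x : X) :
  fhs_eval (f - g) x = fhs_eval f x - fhs_eval g x.
Proof. by rewrite linearB. Qed.

Lemma interpolant_best_approx {C : numClosedFieldType} {X : Type}
    (H : function_hilbert_space C X) (K : X -> X -> C) (e : X -> H)
    (He : reproducing_kernel K e) (A : set X) (f g h : H) :
  lin_span (e @` A) g -> (forall x, A x -> fhs_eval g x = fhs_eval f x) ->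
  lin_span (e @` A) h -> `|f - g| <= `|f - h|.
Proof.
move=> Ag gf Ah; rewrite -(ler_pXn2r (n := 2))// ?nnegrE//.
(* Pythagoras for [f - h = (f - g) + (g - h)]: the second summand lies in the span, and the first is
   orthogonal to it. *)
rewrite !fhs_norm -[f - h](subrKA g) [leRHS]hnormDd.
  by rewrite lerDl dnorm_ge0.
apply: lin_span_orthogonal (lin_span_sub _ _ _ Ag Ah) => _ [x Ax <-].
by rewrite -He.2 fhs_evalB gf// subrr.
Qed.

Lemma eval_norm_le {C : numClosedFieldType} {X : Type}
    (H : function_hilbert_space C X) (K : X -> X -> C) (e : X -> H)
    (He : reproducing_kernel K e) (f : H) (z : X) :
  `|fhs_eval f z| <= `|f| * `|e z|.
Proof.
rewrite -(ler_pXn2r (n := 2)) ?nnegrE ?mulr_ge0//.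
by rewrite exprMn !fhs_norm He.2 dot_CauchySchwarz.
Qed.

(** Brings the first terms into the form of an injective finite family, as positive definiteness
    requires. The size [m] counts the indices below [n] that lie in [I], so it may be less than
    [n]. *)
Lemma first_terms_range {X : Type} (I : set nat) (s : nat -> X) (n : nat) :
  set_inj I s ->
  exists m (z : 'I_m -> X), injective z /\ first_terms I s n = range z.
Proof.
move=> s_inj; pose A := [set k : 'I_n | `[<I k>]]%SET.
have IA (i : 'I_#|A|) : I (enum_val i).
  by have := enum_valP i; rewrite inE => /asboolP.
exists #|A|, (fun i : 'I_#|A| => s (enum_val i)); split=> [i j /s_inj ij|].
  by apply/enum_val_inj/val_inj/ij; rewrite inE; apply: IA.
apply/seteqP; split=> [_ [k [Ik kn] <-]|_ [i _ <-]]; last first.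
  by exists (enum_val i).
have kA : Ordinal kn \in A by rewrite inE; apply/asboolP.
by exists (enum_rank_in kA (Ordinal kn)) => //; rewrite enum_rankK_in.
Qed.

Lemma lin_span_first_terms {C : pzRingType} {V : lmodType C} {X : Type}
    (e : X -> V) (A : set X) (I : set nat) (s : nat -> X) (v : V) :
  set_surj I A s -> lin_span (e @` A) v ->
  exists N, lin_span (e @` first_terms I s N) v.
Proof.
move=> sA [m [a [u [Au ->]]]].
have /choice[k kP] (i : 'I_m) : exists k, I k /\ u i = e (s k).
  by have [x /sA[k Ik <-] <-] := Au i; exists k.
(* A combination uses finitely many points; the successor is there because [first_terms] bounds
   indices strictly. *)
exists (\max_(i < m) k i).+1, m, a, u; split=> // i.
have [Iki ->] := kP i; exists (s (k i)) => //; exists (k i) => //; split=> //.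
by rewrite ltnS leq_bigmax.
Qed.

Lemma first_termsS {X : Type} (I : set nat) (s : nat -> X) (n p : nat) :
  (n <= p)%N -> first_terms I s n `<=` first_terms I s p.
Proof.
by move=> np _ [k [Ik kn] <-]; exists k => //; split=> //; apply: leq_trans np.
Qed.

Lemma whitney_cvg {C : numClosedFieldType} {X : Type}
    (H : function_hilbert_space C X) (K : X -> X -> C)
    (HK : positive_definite K) (e : X -> H) (He : reproducing_kernel K e)
    (A : set X) (I : set nat) (s : nat -> X) (f : H) :
  set_bij I A s -> dense (lin_span (e @` A)) ->
  (fun n => whitney e (first_terms I s n) f) @ \oo --> f.
Proof.
move=> [_ s_inj s_surj] Ad; apply/cvgrPdist_lt => eps eps0.
have [h [fh /(lin_span_first_terms _ _ _ _ _ s_surj)[N hN]]] :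
    ball f eps `&` lin_span (e @` A) !=set0.
  by apply: Ad; [exists f; apply: ballxx|apply: ball_open].
(* From [N] on, [h] competes in the span of the first [n] coherent states, so the best approximation
   is at least as close to [f]. *)
exists N => // n /= Nn.
apply: le_lt_trans (_ : `|f - h| < eps); last by rewrite -ball_normE in fh.
have [m [z [z_inj zE]]] := first_terms_range I s n s_inj.
have [] := whitney_exists H K HK e He m z f z_inj; rewrite -zE => Wspan Wf.
apply: interpolant_best_approx He _ _ _ _ Wspan Wf _.
by apply: lin_spanS hN; apply/image_subset/first_termsS.
Qed.

Lemma eval_cvg {C : numClosedFieldType} {X : Type}
    (H : function_hilbert_space C X) (K : X -> X -> C) (e : X -> H)
    (He : reproducing_kernel K e) (g : nat -> H) (f : H) (z : X) :
  g @ \oo --> f ->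
  (fun n => fhs_eval (g n) z : C^o) @ \oo --> (fhs_eval f z : C^o).
Proof.
move=> /cvgrPdist_lt gf; apply/cvgrPdist_lt => eps eps0.
(* Adding 1 keeps the divisor of [eps] positive even if [e z] is zero. *)
have ez0 : 0 < `|e z| + 1 by rewrite ltr_wpDl.
have [N _ gN] := gf _ (divr_gt0 eps0 ez0).
exists N => // n /gN /=; rewrite ltr_pdivlMr//; apply: le_lt_trans.
rewrite -fhs_evalB; apply: le_trans (eval_norm_le H K e He _ z) _.
by rewrite ler_wpM2l// lerDl.
Qed.

Theorem theorem1p1 (R : realType) (G : lie_group R) (HG : reductive G)
    (X : homogeneous_space G) (H : function_hilbert_space R[i] X)
    (K : X -> X -> R[i]) (HK : positive_definite K)
    (e : X -> H) (He : reproducing_kernel K e)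
    (Gamma : set X) (HGamma : discrete_subspace Gamma)
    (I : set nat) (gamma : nat -> X) (Hgamma : enumeration Gamma I gamma)
    (Hdense : @dense H (lin_span (e @` Gamma))) :
  forall f : H, smooth_cfun (hs_manifold X) (fhs_eval f) ->
    (fun n : nat => whitney e (first_terms I gamma n) f) @ \oo --> f /\
    forall z : X,
      (fun n : nat => fhs_eval (whitney e (first_terms I gamma n) f) z
         : R[i]^o) @ \oo --> (fhs_eval f z : R[i]^o).
Proof.
move=> f _; have Wf := whitney_cvg H K HK e He Gamma I gamma f Hgamma.2 Hdense.
by split=> // z; apply: eval_cvg He _ _ z Wf.
Qed.
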